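(* The group $G = S^1 \ltimes \left((\mu_2)^N \ltimes S_N\right)$, acting on the root covering $(\mathbb{C}^\times)^{N+1}=\mathbb{C}^\times\times(\mathbb{C}^\times)^N$ as described in the context, is a group of ambiguities for phase retrieval on $(\mathbb{C}^\times)^{N+1}$. That is, $G$ acts faithfully on $(\mathbb{C}^\times)^{N+1}$, and for all $\tilde{x}\in(\mathbb{C}^\times)^{N+1}$ and all $g\in G$, the vectors $x=\Phi(\tilde{x})$ and $x'=\Phi(g\tilde{x})$ satisfy $|\hat{x}(\omega)|^2=|\hat{x'}(\omega)|^2$.
   Context: For $x=(x[0],\dots,x[N])\in\mathbb{C}^{N+1}$ the Fourier transform is $\hat{x}(\omega)=\sum_{n=0}^N x[n]\omega^n$ for $\omega$ in the unit circle $S^1\subset\mathbb{C}$, and the Fourier intensity function is $|\hat{x}(\omega)|^2$. Signals have full support ($x[0]\neq0$ and $x[N]\neq 0$), so the space of signals is $\mathbb{C}^\times\times\mathbb{C}^{N-1}\times\mathbb{C}^\times$. The root covering is $\mathbb{C}^\times\times(\mathbb{C}^\times)^N$, with points $(a_0,\beta_1,\dots,\beta_N)$. The map $\Phi:\mathbb{C}^\times\times(\mathbb{C}^\times)^N\to\mathbb{C}^\times\times\mathbb{C}^{N-1}\times\mathbb{C}^\times$ sends $(a_0,\beta_1,\dots,\beta_N)$ to the vector $x$ with $\hat{x}(\omega)=a_0(\omega-\beta_1)\cdots(\omega-\beta_N)$. Here $\mu_2=\{\pm1\}$. The action of $G$ on the root covering is as follows. - $\lambda\in S^1$ acts by $\lambda\cdot(a_0,\beta_1,\dots,\beta_N)=(\lambda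 a_0,\beta_1,\dots,\beta_N)$. - $S_N$ acts by permuting the coordinates $\beta_1,\dots,\beta_N$. - $(\mu_2)^N$ is generated by the elements $s_i=(1,\dots,1,-1,1,\dots,1)$ ($-1$ in position $i$), and $s_i\cdot(a_0,\beta_1,\dots,\beta_N)=(a_0|\beta_i|,\beta_1,\dots,\beta_{i-1},\overline{\beta_i}^{-1},\beta_{i+1},\dots,\beta_N)$. The actions of $S_N$ and $(\mu_2)^N$ do not commute: $\tau s_i\tilde{x}=s_{\tau(i)}\tau\tilde{x}$ for $\tau\in S_N$. This gives an action of the semi-direct product $(\mu_2)^N\ltimes S_N$, in which $S_N$ acts on $(\mu_2)^N$ by permutations. *)

(* Defs.v *)
From HB Require Import structures.
From mathcomp Require Import all_boot all_order all_fingroup all_algebra.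
From mathcomp Require Import reals complex.

Set Implicit Arguments.
Unset Strict Implicit.
Unset Printing Implicit Defensive.

Import Order.TTheory GRing.Theory Num.Theory.
Local Open Scope ring_scope.

Definition faithful_action (G : groupType) (T : Type) (act : G -> T -> T) :=
  [/\ forall x, act 1%g x = x,
      forall g h x, act (g * h)%g x = act g (act h x)
    & forall g, (forall x, act g x = x) -> g = 1%g].

Record autAction (K H : groupType) := AutAction {
  aact :> K -> H -> H;
  aact1 : forall h, aact 1%g h = h;
  aactM : forall k k' h, aact (k * k')%g h = aact k (aact k' h);
  aact_mul : forall k, {morph aact k : h h' / (h * h')%g}
}.

(* H ><| K: the normal factor H comes first. *)
Record semidirect (K H : groupType) (phi : autAction K H) := SDProd {
  sdleft : H;
  sdright : K
}.

Section SemiDirectProduct.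
Variables (K H : groupType) (phi : autAction K H).
Local Notation G := (semidirect phi).
Local Open Scope group_scope.

Definition sdpair (g : G) : H * K := (sdleft g, sdright g).
Definition pairsd (p : H * K) : G := SDProd phi p.1 p.2.
Lemma sdpairK : cancel sdpair pairsd. Proof. by case. Qed.
HB.instance Definition _ := Choice.copy G (can_type sdpairK).

Definition sdone : G := SDProd phi 1 1.
Definition sdmul (g h : G) : G :=
  SDProd phi (sdleft g * phi (sdright g) (sdleft h)) (sdright g * sdright h).
Definition sdinv (g : G) : G :=
  SDProd phi (phi (sdright g)^-1 (sdleft g)^-1) (sdright g)^-1.

Lemma aact_one k : phi k 1 = 1.
Proof. by apply: (mulgI (phi k 1)); rewrite -aact_mul !mulg1. Qed.

Lemma sdmulA : associative sdmul.
Proof.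
by move=> [a b] [c d] [e f]; rewrite /sdmul /= aact_mul aactM !mulgA.
Qed.
Lemma sdmul1 : left_id sdone sdmul.
Proof. by move=> [a b]; rewrite /sdmul /= aact1 !mul1g. Qed.
Lemma sd1mul : right_id sdone sdmul.
Proof. by move=> [a b]; rewrite /sdmul /= aact_one !mulg1. Qed.
Lemma sdmulV : left_inverse sdone sdinv sdmul.
Proof. by move=> [a b]; rewrite /sdmul /sdinv /= -aact_mul !mulVg aact_one. Qed.
Lemma sdVmul : right_inverse sdone sdinv sdmul.
Proof. by move=> [a b]; rewrite /sdmul /sdinv /= -aactM !mulgV aact1 mulgV. Qed.
HB.instance Definition _ := isGroup.Build G sdmulA sdmul1 sd1mul sdmulV sdVmul.
End SemiDirectProduct.

Definition trivial_autAction (K H : groupType) : autAction K H :=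
  @AutAction K H (fun _ h => h) (fun=> erefl) (fun _ _ _ => erefl)
    (fun _ _ _ => erefl).

(* The product of {perm T} is "first s, then t"; here the product is the usual
   composition of functions, so that S_N acts on the left on {0, .., N-1}. *)
Definition symgrp (N : nat) : Type := 'S_N.
HB.instance Definition _ N := Choice.on (symgrp N).

Section SymGroup.
Variable N : nat.
Definition sym_mul (s t : symgrp N) : symgrp N := ((t : 'S_N) * (s : 'S_N))%g.
Definition sym_inv (s : symgrp N) : symgrp N := ((s : 'S_N)^-1)%g.
Definition sym_one : symgrp N := (1 : 'S_N)%g.
Lemma sym_mulA : associative sym_mul.
Proof. by move=> s t u; rewrite /sym_mul mulgA. Qed.
Lemma sym_mul1 : left_id sym_one sym_mul.
Proof. by move=> s; exact: mulg1. Qed.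
Lemma sym_1mul : right_id sym_one sym_mul.
Proof. by move=> s; exact: mul1g. Qed.
Lemma sym_mulV : left_inverse sym_one sym_inv sym_mul.
Proof. by move=> s; exact: mulgV. Qed.
Lemma sym_Vmul : right_inverse sym_one sym_inv sym_mul.
Proof. by move=> s; exact: mulVg. Qed.
HB.instance Definition _ :=
  isGroup.Build (symgrp N) sym_mulA sym_mul1 sym_1mul sym_mulV sym_Vmul.

Lemma symgrpM (s t : symgrp N) i :
  ((s * t)%g : 'S_N) i = (s : 'S_N) ((t : 'S_N) i).
Proof. exact: permM. Qed.

(* The entry at position i is moved to position t i. *)
Definition permute (T : Type) (t : symgrp N) (f : {ffun 'I_N -> T}) :
  {ffun 'I_N -> T} := [ffun j => f ((t : 'S_N)^-1%g j)].
End SymGroup.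

Record mu2 := Mu2 { mu2_val :> int; _ : mu2_val \in [:: 1; -1] }.
HB.instance Definition _ := [isSub for mu2_val].
HB.instance Definition _ := [Choice of mu2 by <:].

Section Mu2Group.
Lemma mu2_one_subproof : (1 : int) \in [:: 1; -1]. Proof. by []. Qed.
Lemma mu2_neg_subproof : (-1 : int) \in [:: 1; -1]. Proof. by []. Qed.
Lemma mu2_mul_subproof (e f : mu2) : (e : int) * (f : int) \in [:: 1; -1].
Proof.
case: e f => e he [f hf] /=; move: he hf; rewrite !inE.
by move=> /orP[]/eqP-> /orP[]/eqP->.
Qed.
Definition mu2_one := Mu2 mu2_one_subproof.
Definition mu2_neg := Mu2 mu2_neg_subproof.
Definition mu2_mul e f := Mu2 (mu2_mul_subproof e f).
Lemma mu2_mulA : associative mu2_mul.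
Proof. by move=> e f g; apply: val_inj; rewrite /= mulrA. Qed.
Lemma mu2_mul1 : left_id mu2_one mu2_mul.
Proof. by move=> e; apply: val_inj; rewrite /= mul1r. Qed.
Lemma mu2_1mul : right_id mu2_one mu2_mul.
Proof. by move=> e; apply: val_inj; rewrite /= mulr1. Qed.
Lemma mu2_mulV : left_inverse mu2_one id mu2_mul.
Proof.
by case=> e he; apply: val_inj => /=; move: he; rewrite !inE => /orP[]/eqP->.
Qed.
HB.instance Definition _ :=
  isGroup.Build mu2 mu2_mulA mu2_mul1 mu2_1mul mu2_mulV mu2_mulV.
End Mu2Group.

Record circle (R : realType) :=
  Circle { circle_val :> R[i]; _ : `|circle_val| == 1 }.
HB.instance Definition _ R := [isSub for @circle_val R].
HB.instance Definition _ R := [Choice of circle R by <:].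

Section CircleGroup.
Variable R : realType.
Lemma circleP (z : circle R) : `|z : R[i]| = 1.
Proof. by apply/eqP; case: z. Qed.
Lemma circle_neq0 (z : circle R) : (z : R[i]) != 0.
Proof. by rewrite -normr_eq0 circleP oner_eq0. Qed.
Lemma circle_one_subproof : `|1 : R[i]| == 1. Proof. by rewrite normr1. Qed.
Lemma circle_mul_subproof (z w : circle R) : `|(z : R[i]) * (w : R[i])| == 1.
Proof. by rewrite normrM !circleP mulr1. Qed.
Lemma circle_inv_subproof (z : circle R) : `|(z : R[i])^-1| == 1.
Proof. by rewrite normfV circleP invr1. Qed.
Definition circle_one := Circle circle_one_subproof.
Definition circle_mul z w := Circle (circle_mul_subproof z w).
Definition circle_inv z := Circle (circle_inv_subproof z).
Lemma circle_mulA : associative circle_mul.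
Proof. by move=> x y z; apply: val_inj; rewrite /= mulrA. Qed.
Lemma circle_mul1 : left_id circle_one circle_mul.
Proof. by move=> x; apply: val_inj; rewrite /= mul1r. Qed.
Lemma circle_1mul : right_id circle_one circle_mul.
Proof. by move=> x; apply: val_inj; rewrite /= mulr1. Qed.
Lemma circle_mulV : left_inverse circle_one circle_inv circle_mul.
Proof. by move=> x; apply: val_inj; rewrite /= mulVf ?circle_neq0. Qed.
Lemma circle_Vmul : right_inverse circle_one circle_inv circle_mul.
Proof. by move=> x; apply: val_inj; rewrite /= mulfV ?circle_neq0. Qed.
HB.instance Definition _ := isGroup.Build (circle R)
  circle_mulA circle_mul1 circle_1mul circle_mulV circle_Vmul.
End CircleGroup.

Record Cx (R : realType) := MkCx { Cx_val :> R[i]; _ : Cx_val != 0 }.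
HB.instance Definition _ R := [isSub for @Cx_val R].
HB.instance Definition _ R := [Choice of Cx R by <:].

Section CxOps.
Variable R : realType.
Lemma Cx_neq0 (z : Cx R) : (z : R[i]) != 0. Proof. by case: z. Qed.
Lemma Cx_mul_subproof (z w : Cx R) : (z : R[i]) * (w : R[i]) != 0.
Proof. by rewrite mulf_neq0 ?Cx_neq0. Qed.
Lemma Cx_norm_subproof (z : Cx R) : `|z : R[i]| != 0.
Proof. by rewrite normr_eq0 Cx_neq0. Qed.
Lemma Cx_refl_subproof (z : Cx R) : ((z : R[i])^* )^-1 != 0.
Proof. by rewrite invr_eq0 conjC_eq0 Cx_neq0. Qed.
Definition Cx_mul z w := MkCx (Cx_mul_subproof z w).
Definition Cx_norm z := MkCx (Cx_norm_subproof z).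
Definition Cx_refl z := MkCx (Cx_refl_subproof z).
Definition Cx_of_circle (z : circle R) := MkCx (circle_neq0 z).
End CxOps.

Section PhaseRetrieval.
Variables (R : realType) (N : nat).
Local Notation C := R[i].

Record signal := Signal {
  entries :> {ffun 'I_N.+1 -> C};
  _ : (entries ord0 != 0) && (entries ord_max != 0)
}.

Definition fourier (x : signal) (w : circle R) : C :=
  \sum_(n < N.+1) x n * (w : C) ^+ n.

Definition intensity (x : signal) (w : circle R) : C := `|fourier x w| ^+ 2.

Definition rootcover : Type := Cx R * {ffun 'I_N -> Cx R}.

Definition root_poly (x : rootcover) : {poly C} :=
  (x.1 : C) *: \prod_(i < N) ('X - (x.2 i : C)%:P).

Lemma size_root_poly x : size (root_poly x) = N.+1.
Proof.
rewrite size_scale ?Cx_neq0 // -(big_map (fun i => (x.2 i : C)) xpredT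
  (fun z => 'X - z%:P)) size_prod_XsubC size_map.
by rewrite /index_enum -enumT size_enum_ord.
Qed.

Lemma Phi_subproof (x : rootcover) :
  let c := [ffun n : 'I_N.+1 => (root_poly x)`_n] in
  (c ord0 != 0) && (c ord_max != 0).
Proof.
rewrite /= !ffunE /=; apply/andP; split.
  rewrite -horner_coef0 hornerZ mulf_neq0 ?Cx_neq0 // horner_prod.
  by apply/prodf_neq0 => i _; rewrite !hornerE oppr_eq0 Cx_neq0.
have -> : (root_poly x)`_N = lead_coef (root_poly x).
  by rewrite lead_coefE size_root_poly.
by rewrite lead_coef_eq0 -size_poly_eq0 size_root_poly.
Qed.

Definition Phi (x : rootcover) : signal := Signal (Phi_subproof x).

Lemma fourier_Phi x w :
  fourier (Phi x) w = (x.1 : C) * \prod_(i < N) ((w : C) - (x.2 i : C)).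
Proof.
have -> : fourier (Phi x) w = (root_poly x).[w : C].
  rewrite horner_coef size_root_poly.
  by apply: eq_bigr => n _; rewrite ffunE.
rewrite hornerZ horner_prod; congr (_ * _).
by apply: eq_bigr => i _; rewrite !hornerE.
Qed.

Lemma permute1 (T : Type) (f : {ffun 'I_N -> T}) :
  permute (1%g : symgrp N) f = f.
Proof. by apply/ffunP => j; rewrite ffunE invg1 perm1. Qed.

Lemma permuteM (T : Type) (s t : symgrp N) (f : {ffun 'I_N -> T}) :
  permute (s * t)%g f = permute s (permute t f).
Proof. by apply/ffunP => j; rewrite !ffunE invMg permM. Qed.

Lemma permute_mul (t : symgrp N) :
  {morph @permute N mu2 t : e f / (e * f)%g}.
Proof. by move=> e f; apply/ffunP => j; rewrite !ffunE. Qed.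

Definition perm_signs : autAction (symgrp N) {ffun 'I_N -> mu2} :=
  AutAction (@permute1 mu2) (@permuteM mu2) permute_mul.

(* S^1 commutes with the other factors: the conjugation action on it is
   trivial, which is the only choice compatible with the action below. *)
Definition ambG : Type :=
  semidirect (trivial_autAction (semidirect perm_signs) (circle R)).
HB.instance Definition _ := Group.on ambG.

Definition phase_act (l : circle R) (x : rootcover) : rootcover :=
  (Cx_mul (Cx_of_circle l) x.1, x.2).

Definition perm_act (t : symgrp N) (x : rootcover) : rootcover :=
  (x.1, permute t x.2).

Definition flip (i : 'I_N) : {ffun 'I_N -> mu2} :=
  [ffun j => if j == i then mu2_neg else 1%g].

Definition flip_act (i : 'I_N) (x : rootcover) : rootcover :=
  (Cx_mul x.1 (Cx_norm (x.2 i)),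
   [ffun j => if j == i then Cx_refl (x.2 i) else x.2 j]).

(* (mu_2)^N acts through its generators [flip i]; these commute, so the order
   of the composition is irrelevant. *)
Definition sign_act (e : {ffun 'I_N -> mu2}) : rootcover -> rootcover :=
  \big[(fun f g => f \o g) / id]_(i < N | (e i : int) == -1) flip_act i.

Lemma sign_act_flip i x : sign_act (flip i) x = flip_act i x.
Proof.
rewrite /sign_act (eq_bigl (pred1 i)); last first.
  by move=> j; rewrite ffunE /=; case: (j == i).
rewrite -big_filter filter_pred1_uniq ?index_enum_uniq ?mem_index_enum //.
by rewrite unlock.
Qed.

Lemma perm_flip_act (t : symgrp N) i x :
  perm_act t (flip_act i x) = flip_act ((t : 'S_N) i) (perm_act t x).
Proof.
rewrite /perm_act /flip_act /= !ffunE permK; congr (_, _).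
apply/ffunP => j; rewrite !ffunE; congr (if _ then _ else _).
by rewrite (canF_eq (permKV t)).
Qed.

Definition amb_act (g : ambG) (x : rootcover) : rootcover :=
  phase_act (sdleft g)
    (sign_act (sdleft (sdright g)) (perm_act (sdright (sdright g)) x)).

End PhaseRetrieval.

(* Main.v *)
(* On explicit formulas, an element [e] of (mu_2)^N multiplies the leading
   coefficient by the product of the moduli of the roots it reflects.  The
   intensity is invariant because [|w - b| = |b| |w - 1/conj b|] for [|w| = 1].
   Faithfulness is witnessed by a single point, with leading coefficient [1] and
   roots [2, 3, ..., N + 1]: reflecting any of them leads inside the unit
   disc, so an element fixing this point has trivial sign part, then trivial
   permutation part since the roots are distinct, then trivial phase. *)
Require Import Defs.
From mathcomp Require Import all_boot reals.
From mathcomp Require Import all_order all_fingroup all_algebra complex.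

Set Implicit Arguments.
Unset Strict Implicit.
Unset Printing Implicit Defensive.

Import Order.TTheory GRing.Theory Num.Theory.
Local Open Scope ring_scope.

Lemma mu2P (e : mu2) : e = 1%g \/ e = mu2_neg.
Proof.
case: e => e he; have := he; rewrite !inE.
by case/orP=> /eqP E; [left | right]; apply: val_inj; rewrite /= E.
Qed.

(** Being -1 turns the product of signs into exclusive or, so composed reflections can be compared
    by cases on two booleans. *)
Lemma mu2_mul_neg (e f : mu2) :
  (((e * f)%g : int) == -1) = ((e : int) == -1) (+) ((f : int) == -1).
Proof. by case: (mu2P e) => ->; case: (mu2P f) => ->. Qed.

Section Action.
Variables (R : realType) (N : nat).
Implicit Types (x y : rootcover R N) (e f : {ffun 'I_N -> mu2}).

Lemma rootcoverP x y :
  (x.1 : R[i]) = y.1 -> (forall j, (x.2 j : R[i]) = y.2 j) -> x = y.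
Proof.
case: x y => [a b] [c d] /= /val_inj-> bd; congr (_, _).
by apply/ffunP => j; exact/val_inj/bd.
Qed.

(** A duplicate-free list in place of the full index range makes induction possible. The flips of
    the tail are applied first and leave root [i] alone, so the new factor is the modulus of the
    original root. *)
Lemma sign_act_seqE e (r : seq 'I_N) x : uniq r ->
  let y := (\big[(fun u v => u \o v) / id]_(i <- r | (e i : int) == -1)
              @flip_act R N i) x in
  (y.1 : R[i]) =
    (x.1 : R[i]) * \prod_(i <- r | (e i : int) == -1) `|x.2 i : R[i]| /\
  forall j, y.2 j =
    if (j \in r) && ((e j : int) == -1) then Cx_refl (x.2 j) else x.2 j.
Proof.
elim: r => [_|i r IHr /= /andP[ir /IHr[IH1 IH2]]] /=.
  by rewrite !big_nil mulr1.
rewrite !big_cons; case: ifPn => ei.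
  rewrite /= IH1 IH2 (negPf ir) /= -mulrA [_ * `|_|]mulrC; split=> // j.
  rewrite ffunE inE IH2; have [->|//] := eqVneq j i.
  by rewrite ei.
split=> // j; rewrite IH2 inE; have [->|//] := eqVneq j i.
by rewrite (negPf ei) !andbF.
Qed.

Lemma sign_act1E e x : ((sign_act e x).1 : R[i]) =
  (x.1 : R[i]) * \prod_(i | (e i : int) == -1) `|x.2 i : R[i]|.
Proof. by have [] := sign_act_seqE e x (index_enum_uniq 'I_N). Qed.

Lemma sign_act2E e x j : (sign_act e x).2 j =
  if (e j : int) == -1 then Cx_refl (x.2 j) else x.2 j.
Proof.
have [_ ->] := sign_act_seqE e x (index_enum_uniq 'I_N).
by rewrite mem_index_enum.
Qed.

Lemma sign_act1 x : sign_act 1%g x = x.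
Proof.
apply: rootcoverP => [|j]; last by rewrite sign_act2E ffunE.
by rewrite sign_act1E big1 ?mulr1 // => i; rewrite ffunE.
Qed.

(** Reflection is an involution, and where both signs are -1 the factors |b| and |1/conj b|
    cancel. *)
Lemma sign_actM e f x : sign_act (e * f)%g x = sign_act e (sign_act f x).
Proof.
apply: rootcoverP => [|j]; last first.
  rewrite !sign_act2E ffunE mu2_mul_neg.
  case: (_ == -1); case: (_ == -1) => //=.
  by rewrite rmorphV ?unitfE ?conjC_eq0 ?Cx_neq0 //= conjCK invrK.
rewrite !sign_act1E -mulrA; congr (_ * _).
(* Unselected indices contribute 1, so the three products share one index set and are compared
   factor by factor. *)
rewrite big_mkcond [in RHS]big_mkcond [X in _ * X]big_mkcond -big_split /=.
apply: eq_bigr => i _; rewrite sign_act2E ffunE mu2_mul_neg.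
case: (_ == -1); case: (_ == -1) => //=; rewrite ?mulr1 ?mul1r //.
by rewrite normfV norm_conjC divff ?normr_eq0 ?Cx_neq0.
Qed.

(** Extends the commutation rule for generators to all sign vectors; this is the twist in the
    semidirect product, needed to move [s] past [f] in [amb_actM]. *)
Lemma perm_sign_act (t : symgrp N) e x :
  perm_act t (sign_act e x) = sign_act (permute t e) (perm_act t x).
Proof.
apply: rootcoverP => [|j].
  rewrite !sign_act1E /=; congr (_ * _).
  rewrite (reindex_inj (@perm_inj _ (t : 'S_N)^-1%g)) /=.
  by apply: eq_big => i => [|_]; rewrite !ffunE.
by rewrite sign_act2E !ffunE sign_act2E.
Qed.

Lemma perm_act1 x : perm_act 1%g x = x.
Proof. by case: x => a b; rewrite /perm_act permute1. Qed.

Lemma perm_actM (s t : symgrp N) x :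
  perm_act (s * t)%g x = perm_act s (perm_act t x).
Proof. by rewrite /perm_act permuteM. Qed.

Lemma phase_act1 x : phase_act 1%g x = x.
Proof. by apply: rootcoverP => //=; rewrite mul1r. Qed.

Lemma phase_actM (l m : circle R) x :
  phase_act (l * m)%g x = phase_act l (phase_act m x).
Proof. by apply: rootcoverP => //=; rewrite mulrA. Qed.

Lemma sign_phase_act e (l : circle R) x :
  sign_act e (phase_act l x) = phase_act l (sign_act e x).
Proof.
apply: rootcoverP => [|j]; last by rewrite /= !sign_act2E.
by rewrite /= !sign_act1E /= mulrA.
Qed.

Lemma perm_phase_act (t : symgrp N) (l : circle R) x :
  perm_act t (phase_act l x) = phase_act l (perm_act t x).
Proof. by []. Qed.

Lemma amb_act1 x : amb_act 1%g x = x.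
Proof. by rewrite /amb_act /= perm_act1 sign_act1 phase_act1. Qed.

Lemma amb_actM (g h : ambG R N) x :
  amb_act (g * h)%g x = amb_act g (amb_act h x).
Proof.
case: g h => [l [e s]] [m [f t]]; rewrite /amb_act /=.
by rewrite phase_actM sign_actM perm_actM perm_phase_act perm_sign_act
  sign_phase_act.
Qed.

Lemma natCx_neq0 n : n.+2%:R != 0 :> R[i].
Proof. by rewrite pnatr_eq0. Qed.

(** Indices start at 0; the shift by 2 keeps every root off the unit circle, whose points are fixed
    by reflection. *)
Definition generic_point : rootcover R N :=
  (MkCx (oner_neq0 R[i]), [ffun i : 'I_N => MkCx (natCx_neq0 i)]).

Lemma generic_point_free (g : ambG R N) :
  amb_act g generic_point = generic_point -> g = 1%g.
Proof.
case: g => [l [e t]]; rewrite /amb_act /= => fix_g.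
have root_fix j : (if (e j : int) == -1
    then Cx_refl (generic_point.2 ((t : 'S_N)^-1%g j))
    else generic_point.2 ((t : 'S_N)^-1%g j)) = generic_point.2 j.
  by rewrite -[in RHS]fix_g /= sign_act2E !ffunE.
have e_eq1 : e = 1%g.
  apply/ffunP => j; rewrite ffunE; case: (mu2P (e j)) => // ej.
  have /(congr1 (@Cx_val R)) := root_fix j; rewrite ej /= !ffunE /= => E.
  (* With a the root at [t^-1 j], [E] says that 1/a is the root at [j], so 1 = (1/a) a would be a
     product of two integers that are at least 2. *)
  have : 1 < (1 : R[i]); last by rewrite ltxx.
  rewrite -[X in _ < X](mulVf (natCx_neq0 ((t : 'S_N)^-1%g j))).
  rewrite conjC_nat in E; rewrite E -natrM ltr1n.
  by rewrite mulSn addSn.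
have t_eq1 : t = 1%g.
  (* [symgrp] reverses the product of ['S_N] but has the same inverse and unit. *)
  suff tV : (t : 'S_N)^-1%g = 1%g by rewrite -[t]invgK [t^-1%g]tV invg1.
  apply/permP => j; rewrite perm1; apply: val_inj.
  have /(congr1 (@Cx_val R)) := root_fix j; rewrite e_eq1 !ffunE /=.
  by move/eqP; rewrite eqr_nat => /eqP[].
have l_eq1 : l = 1%g.
  (* Once the signs are trivial, the leading coefficient 1 is only multiplied by [l]. *)
  apply: val_inj => /=; have /(congr1 (fun x => Cx_val x.1)) := fix_g.
  by rewrite e_eq1 sign_act1 /= mulr1.
by rewrite l_eq1 e_eq1 t_eq1.
Qed.

Lemma norm_sub_refl (w : circle R) (b : Cx R) :
  `|b : R[i]| * `|(w : R[i]) - (Cx_refl b : R[i])| = `|(w : R[i]) - (b : R[i])|.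
Proof.
have b0 : (b : R[i])^* != 0 by rewrite conjC_eq0 Cx_neq0.
have wV : (w : R[i])^* * w = 1 by rewrite mulrC -normCK circleP expr1n.
rewrite -[in LHS]norm_conjC -normrM mulrBr divff //.
(* Writing the constant 1 as conj(w) w lets the unimodular factor w be pulled out, leaving |conj(b)
   - conj(w)|. *)
rewrite -wV -mulrBl normrM circleP mulr1.
by rewrite -rmorphB norm_conjC distrC.
Qed.

Lemma norm_fourier_phase l x w :
  `|fourier (Phi (phase_act l x)) w| = `|fourier (Phi x) w|.
Proof. by rewrite !fourier_Phi /= -mulrA normrM circleP mul1r. Qed.

Lemma fourier_perm t x w :
  fourier (Phi (perm_act t x)) w = fourier (Phi x) w.
Proof.
rewrite !fourier_Phi /=; congr (_ * _).
rewrite [RHS](reindex_inj (@perm_inj _ (t : 'S_N)^-1%g)) /=.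
by apply: eq_bigr => i _; rewrite ffunE.
Qed.

Lemma norm_fourier_sign e x w :
  `|fourier (Phi (sign_act e x)) w| = `|fourier (Phi x) w|.
Proof.
rewrite !fourier_Phi sign_act1E !normrM -mulrA; congr (_ * _).
(* Each modulus picked up by the leading coefficient is paired with the reflected root that produced
   it, which reduces the claim to a single root. *)
rewrite !normr_prod big_mkcond -big_split /=; apply: eq_bigr => i _.
rewrite sign_act2E; case: ifP => _; last by rewrite mul1r.
by rewrite normr_id norm_sub_refl.
Qed.

End Action.

Theorem theorem3p3 (R : realType) (N : nat) (hN : (0 < N)%N) :
  faithful_action (@amb_act R N) /\
  (forall (xt : rootcover R N) (g : ambG R N) (w : circle R),
     intensity (Phi xt) w = intensity (Phi (amb_act g xt)) w).
Proof.
split.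
  split; [exact: amb_act1 | exact: amb_actM |].
  by move=> g fix_g; exact/generic_point_free/fix_g.
move=> xt g w; rewrite /intensity /amb_act norm_fourier_phase.
by rewrite norm_fourier_sign fourier_perm.
Qed.
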